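(* Let $L$ be an oriented non-split alternating link with consolidated Tait graphs $G_B^*$, $G_W^*$ and weighted adjacency matrices $\overline A_B$, $\overline A_W$, and let $X_B$, $X_W$ be diagonal matrices of independent commuting vertex variables of the corresponding sizes. Then $$\operatorname{sq}\Bigl(-\log\det\bigl(I-tX_B\overline A_B\bigr)\Bigr)\Big|_{t=1}=CB_2(w^2,r^2)+2\sum_{i>2}CB_i(w,r),$$ and the same identity holds with $B$ replaced by $W$ (i.e. with $X_W$, $\overline A_W$, $CW_2$, $CW_i$). Hence the unordered pair of these two evaluations is exactly the invariant $WRP(w,r)$ of $L$.
   Context: Tait graphs and $CWR$. Let $D$ be a reduced (no nugatory crossings) alternating diagram of an oriented non-split alternating link $L$. The regions of $D$ are checkerboard coloured black and white, so that regions sharing an edge have opposite colours; which class is called black is fixed once and for all by a local rule depending on the over/under pattern at crossings, the same rule for all diagrams (the statement holds for either choice of rule). The Tait graph $G_B$ has one vertex for each black region and one edge for each crossing, joining the black regions meeting at that crossing; $G_W$ is defined in the same way from white regions. Each edge $e$ gets weight $\operatorname{wg}(e)=w$ if the crossing is positive and $r$ if it is negative, where $w,r$ are commuting indeterminates. The consolidated Tait graph $G_B^*$ is the weighted simple graph obtained from $G_B$ by replacing all parallel edges joining the same pair of vertices by a single edge whose weight is the product of their weights; $G_W^*$ is obtained from $G_W$ likewise. For $i>2$, $CB_i(w,r)=\sum_C\prod_{e\in E(C)}\operatorname{wg}(e)$, summed over all unoriented simple cycles $C$ of length $i$ in $G_B^*$; $CB_2(w,r)=\sum_{e\in E(G_B^*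 )}\operatorname{wg}(e)$; $CW_i$ is defined analogously from $G_W^*$. It is a known theorem that the $CB_i$ and $CW_i$ do not depend on the chosen reduced alternating diagram $D$ of $L$. The $WRP$ invariant. From $G_B^*$ and $G_W^*$ form directed graphs $G_B'$ and $G_W'$ by replacing every edge by two oppositely oriented edges with the same weight. $WRP(w,r)$ is the unordered pair of polynomials obtained from $G_B'$ and $G_W'$ by summing, over all directed simple cycles (including the directed $2$-cycles formed by a pair of opposite edges; cycles are counted without a base point), the products of the edge weights. The weighted adjacency matrix of a simple loopless weighted graph has $(i,j)$ entry equal to the weight of the edge $v_iv_j$ if it exists, and $0$ otherwise. The logarithm is the formal one, $\log(1+u)=\sum_{j\ge1}(-1)^{j+1}u^j/j$, applied to $\det(I-tX\overline A)\in 1+t\,\mathbb{Z}[w,r][x_1,\dots,x_n][t]$. For $P=\sum_\alpha c_\alpha x^\alpha\in\mathbb{Q}[w,r][x_1,\ldots,x_n]$, $\operatorname{sq}(P)=\sum_{\alpha\in\{0,1\}^n}c_\alpha$ is the sum of the coefficients of the squarefree monomials, extended coefficientwise to power series in $t$. The series $\operatorname{sq}(-\log\det(I-tX\overline A))$ is a polynomial in $t$, so it may be evaluated at $t=1$. *)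

(* Defs.v *)
From HB Require Import structures.
From mathcomp Require Export all_boot all_order all_algebra.
From mathcomp Require Export finmap multiset.
From mathcomp Require Export mpoly.

Set Implicit Arguments.
Unset Strict Implicit.
Unset Printing Implicit Defensive.

Import GRing.Theory.

Local Open Scope nat_scope.

(* A crossing c carries four darts (half-edges) (c,0), ..., (c,3), numbered
   counterclockwise so that (c,0) is the incoming and (c,2) the outgoing end of
   the under-strand; (c,1) and (c,3) are the ends of the over-strand.  The
   corner between the darts (c,i) and (c,i+1) is denoted by (c,i) as well. *)
Definition dart (n : nat) : finType := ('I_n * 'I_4)%type.

Definition rot (n : nat) (k : 'I_4) (x : dart n) : dart n :=
  (x.1, (x.2 + k)%R).

Definition opp_dart (n : nat) (x : dart n) : dart n := rot 2%R x.

Definition over (n : nat) (x : dart n) : bool := odd x.2.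

(* At a positive crossing the over-strand runs from (c,3) to (c,1), at a
   negative one from (c,1) to (c,3). *)
Definition incoming (n : nat) (pos : pred 'I_n) (x : dart n) : bool :=
  (x.2 == 0%R) || (x.2 == (if pos x.1 then 3%:R else 1)%R).

Section Shadow.

(* E x is the dart at the other end of the edge that starts with x. *)
Variables (n : nat) (E : dart n -> dart n).

(* The next corner of the region containing the corner x, which lies to the
   left of the edge leaving along the dart x. *)
Definition face_next (x : dart n) : dart n := rot (-1)%R (E x).

Definition region (x : dart n) : {set dart n} :=
  [set y | fconnect face_next x y].

Definition regions : {set {set dart n}} := [set region x | x in dart n].

Definition linked : rel (dart n) := [rel x y | (x.1 == y.1) || (y == E x)].

Definition n_pieces : nat := n_comp linked predT.

Definition strand_next (x : dart n) : dart n := E (opp_dart x).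

Definition n_strands (pos : pred 'I_n) : nat :=
  #|[set [set y | fconnect strand_next x y] | x in incoming pos]|.

End Shadow.

(* Components of the diagram without crossings are only counted
   (d_circles).  The planarity condition is Euler's formula (there are twice as
   many edges as crossings); it says that every connected piece of the diagram
   has genus 0.  The relative position of different pieces is not recorded: it
   is irrelevant for the link. *)
Record diagram := Diagram {
  d_ncross : nat;
  d_positive : pred 'I_d_ncross;
  d_edge : dart d_ncross -> dart d_ncross;
  d_circles : nat;
  d_edgeK : involutive d_edge;
  d_edge_oriented :
    forall x, incoming d_positive (d_edge x) = ~~ incoming d_positive x;
  d_planar : #|regions d_edge| = d_ncross + 2 * n_pieces d_edge
}.

Definition connected_diagram (D : diagram) : bool :=
  n_pieces (@d_edge D) + d_circles D == 1.

Definition n_link_components (D : diagram) : nat :=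
  n_strands (@d_edge D) (@d_positive D) + d_circles D.

(* Going along any component, over- and undercrossings alternate. *)
Definition alternating (D : diagram) : Prop :=
  forall x : dart (d_ncross D), over (d_edge x) = ~~ over x.

(* A crossing is nugatory if some region meets it in two opposite corners. *)
Definition nugatory (D : diagram) (c : 'I_(d_ncross D)) : Prop :=
  exists i : 'I_4,
    region (@d_edge D) (c, i) = region (@d_edge D) (opp_dart (c, i)).

Definition reduced (D : diagram) : Prop :=
  forall c : 'I_(d_ncross D), ~ nugatory c.

Section Moves.

Variables D D' : diagram.
Let n := d_ncross D.
Let n' := d_ncross D'.
Let E : dart n -> dart n := @d_edge D.
Let E' : dart n' -> dart n' := @d_edge D'.

Definition lift_dart (f : 'I_n' -> 'I_n) (x : dart n') : dart n :=
  (f x.1, x.2).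

(* D' is obtained from D by removing the crossings in Z and joining the four
   ends at each of them along the two strands; the edges of D' are the paths of
   D that go straight through crossings of Z.  Components all of whose crossings
   are removed become circles: this is the condition on n_link_components. *)
Definition removes (Z : {set 'I_n}) : Prop :=
  exists f : 'I_n' -> 'I_n,
    [/\ injective f, f @: [set: 'I_n'] = ~: Z,
        forall c, d_positive (f c) = d_positive c,
        forall x y : dart n', (E' x == y) =
          connect [rel u v | (u.1 \in Z) && (v == strand_next E u)]
            (E (lift_dart f x)) (lift_dart f y)
      & n_link_components D' = n_link_components D].

Definition reidemeister1 : Prop :=
  exists x : dart n, E x = rot 1%R x /\ removes [set x.1].

(* The edges leaving x and rot 1 x bound a bigon; one strand is over at both
   crossings. *)
Definition reidemeister2 : Prop :=
  exists x y : dart n,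
    [/\ x.1 != y.1, E x = rot 1%R y, E (rot 1%R x) = y,
        over x = over (rot 1%R y)
      & removes [set x.1; y.1]].

(* D' is obtained from D by renaming the crossings with f and conjugating the
   edges by tau. *)
Definition rewires (tau : dart n -> dart n) : Prop :=
  exists f : 'I_n' -> 'I_n,
    [/\ bijective f, forall c, d_positive (f c) = d_positive c,
        forall x, lift_dart f (E' x) = tau (E (tau (lift_dart f x)))
      & d_circles D' = d_circles D].

Definition same_diagram : Prop := rewires id.

(* The edges leaving the darts in T bound a triangle.  Each of its three
   strands meets two of the three crossings; the map exchanges, for each strand,
   the incoming ends and the outgoing ends at its two crossings, so that after
   the move the strand traverses them in the opposite order. *)
Definition triangle_swap (T : seq (dart n)) (y : dart n) : dart n :=
  if (y \in T) || (E y \in T) then opp_dart (E y)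
  else if (opp_dart y \in T) || (E (opp_dart y) \in T) then E (opp_dart y)
  else y.

Definition reidemeister3 : Prop :=
  exists x : dart n,
    let T := traject (face_next E) x 3 in
    [/\ face_next E (last x T) = x, uniq (map fst T),
        has (fun z => over z && over (E z)) T
      & rewires (triangle_swap T)].

End Moves.

Inductive link_equiv : diagram -> diagram -> Prop :=
| LinkSame D D' of same_diagram D D' : link_equiv D D'
| LinkR1 D D' of reidemeister1 D D' : link_equiv D D'
| LinkR2 D D' of reidemeister2 D D' : link_equiv D D'
| LinkR3 D D' of reidemeister3 D D' : link_equiv D D'
| LinkSym D D' of link_equiv D D' : link_equiv D' D
| LinkTrans D1 D2 D3 of link_equiv D1 D2 & link_equiv D2 D3 :
    link_equiv D1 D3.

(* An oriented link, given by the class of its diagrams. *)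
Record link := Link {
  diagram_of : diagram -> Prop;
  link_class : exists D, forall D', diagram_of D' <-> link_equiv D D'
}.

(* The diagrams of a split link include a disconnected one. *)
Definition non_split (L : link) : Prop :=
  forall D, diagram_of L D -> connected_diagram D.

Definition alternating_link (L : link) : Prop :=
  exists D, diagram_of L D /\ alternating D.

Section Graphs.

Variable R : comNzRingType.

Record wmultigraph := WMultigraph {
  mg_point : finType;
  mg_verts : {set mg_point};
  mg_edge : finType;
  mg_ends : mg_edge -> {set mg_point};
  mg_weight : mg_edge -> R
}.

(* An edge is the set of its two ends. *)
Record wgraph := WGraph {
  g_point : finType;
  g_verts : {set g_point};
  g_edges : {set {set g_point}};
  g_weight : {set g_point} -> R
}.

Definition consolidate (M : wmultigraph) : wgraph :=
  {| g_point := mg_point M;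
     g_verts := mg_verts M;
     g_edges := [set mg_ends x | x in mg_edge M];
     g_weight := fun e =>
       (\prod_(x : mg_edge M | mg_ends x == e) mg_weight x)%R |}.

Record wdigraph := WDigraph {
  dg_point : finType;
  dg_verts : {set dg_point};
  dg_arcs : {set dg_point * dg_point};
  dg_weight : dg_point * dg_point -> R
}.

Definition bidirect (G : wgraph) : wdigraph :=
  {| dg_point := g_point G;
     dg_verts := g_verts G;
     dg_arcs := [set a | [set a.1; a.2] \in g_edges G];
     dg_weight := fun a => g_weight [set a.1; a.2] |}.

Definition adjacency (G : wgraph) : 'M[R]_#|g_verts G| :=
  \matrix_(i, j)
    let e := [set enum_val i; enum_val j] in
    if e \in g_edges G then g_weight e else 0%R.

(* Simple cycles are represented by their sets of edges (arcs); for unoriented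
   cycles this is used for lengths i > 2 only. *)
Definition cycle_edges (G : wgraph) (s : seq (g_point G)) :
    {set {set g_point G}} :=
  [set [set x; next s x] | x in s].

Definition simple_cycles (G : wgraph) (i : nat) : {set {set {set g_point G}}} :=
  [set cycle_edges s | s : i.-tuple (g_point G)
    & uniq s && (cycle_edges s \subset g_edges G)].

Definition cycle_arcs (G : wdigraph) (s : seq (dg_point G)) :
    {set dg_point G * dg_point G} :=
  [set (x, next s x) | x in s].

Definition directed_cycles (G : wdigraph) (i : nat) :
    {set {set dg_point G * dg_point G}} :=
  [set cycle_arcs s | s : i.-tuple (dg_point G)
    & uniq s && (cycle_arcs s \subset dg_arcs G)].

Definition cycle_poly (G : wgraph) (i : nat) : R :=
  (if i == 2%N then \sum_(e in g_edges G) g_weight e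
   else \sum_(C in simple_cycles G i) \prod_(e in C) g_weight e)%R.

Definition directed_cycle_sum (G : wdigraph) : R :=
  (\sum_(1 <= i < #|dg_verts G|.+1)
     \sum_(C in directed_cycles G i) \prod_(a in C) dg_weight a)%R.

End Graphs.

Notation Qwr := {mpoly rat[2]}.

Definition var_w : Qwr := 'X_(0 : 'I_2)%R.
Definition var_r : Qwr := 'X_(1 : 'I_2)%R.

Section Tait.

(* The colouring rule: with b = true, the corners (c,1) and (c,3), swept by the
   over-strand when it is rotated counterclockwise, have colour b; with
   b = false, the corners (c,0) and (c,2) do. *)
Variables (D : diagram) (b : bool).

Definition coloured (F : {set dart (d_ncross D)}) : bool :=
  [exists x in F, odd x.2 == b].

(* A circle without crossings bounds one region of each colour. *)
Definition tait_point : finType :=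
  ({set dart (d_ncross D)} + 'I_(d_circles D))%type.

Definition tait_graph : wmultigraph Qwr :=
  {| mg_point := tait_point;
     mg_verts := [set inl F | F in regions (@d_edge D) & coloured F]
                   :|: [set inr k | k : 'I_(d_circles D)];
     mg_edge := 'I_(d_ncross D);
     mg_ends := fun c =>
       [set inl (region (@d_edge D) (c, i)) | i : 'I_4 & odd i == b];
     mg_weight := fun c => if d_positive c then var_w else var_r |}.

Definition tait_consolidated : wgraph Qwr := consolidate tait_graph.

Definition tait_directed : wdigraph Qwr := bidirect tait_consolidated.

End Tait.

(* The rule fixes the colour called black; white is the other one. *)
Definition GB (rule : bool) (D : diagram) := tait_consolidated D rule.
Definition GW (rule : bool) (D : diagram) := tait_consolidated D (~~ rule).

Definition CB (rule : bool) (D : diagram) (i : nat) : Qwr :=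
  cycle_poly (GB rule D) i.
Definition CW (rule : bool) (D : diagram) (i : nat) : Qwr :=
  cycle_poly (GW rule D) i.

(* The unordered pair is the multiset with its two entries. *)
Definition WRP (rule : bool) (D : diagram) : {mset Qwr}%mset :=
  [mset directed_cycle_sum (tait_directed D rule);
        directed_cycle_sum (tait_directed D (~~ rule))]%mset.

(* In an alternating diagram the colour of a region is that of any of its
   corners; in particular, the two regions along an edge (those of the corners
   x and rot (-1) x) have opposite colours. *)
Fact coloured_region (D : diagram) (b : bool) (x : dart (d_ncross D)) :
  alternating D -> coloured b (region (@d_edge D) x) = (odd x.2 == b).
Proof.
move=> altD.
have step y : odd (face_next (@d_edge D) y).2 = odd y.2.
  have := altD y; rewrite /over /face_next /rot /=.
  by case: (d_edge y) => c [] [|[|[|[|j]]]] //= _;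
     case: (odd y.2).
have inv y : y \in region (@d_edge D) x -> odd y.2 = odd x.2.
  rewrite inE => /iter_findex <-.
  by elim: (findex _ _ _) => //= k IH; rewrite step.
apply/exists_inP/idP => [[y yx]|xb]; first by rewrite (inv _ yx).
by exists x; rewrite ?inE ?connect0.
Qed.

Section Log.

Local Open Scope ring_scope.

Variable n : nat.

Notation vars_ring := {mpoly Qwr[n]}.

Definition rat_const (q : rat) : vars_ring := (q%:MP_[2])%:MP_[n].

(* Formal power series in t are given by their sequences of coefficients.
   formal_log f is log(1 + u), u = f - 1, for f with constant term 1: then
   u^j has no terms of degree less than j, so that the coefficient of t^k is
   a sum over 1 <= j <= k. *)
Definition formal_log (f : {poly vars_ring}) (k : nat) : vars_ring :=
  \sum_(1 <= j < k.+1) rat_const ((-1) ^+ j.+1 / j%:R) * ((f - 1) ^+ j)`_k.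

Definition sq (P : vars_ring) : Qwr :=
  \sum_(S : {set 'I_n}) P@_[multinom (i \in S : nat) | i < n].

Definition char_det (A : 'M[Qwr]_n) : {poly vars_ring} :=
  \det (1%:M - 'X *: map_mx polyC
    (diag_mx (\row_(i < n) 'X_i) *m map_mx (@mpolyC n Qwr) A)).

Definition sq_neg_log_det (A : 'M[Qwr]_n) (k : nat) : Qwr :=
  sq (- formal_log (char_det A) k).

End Log.

(* Main.v *)
(* Since [- log det (I - tM) = sum_k t^k tr(M^k) / k], the coefficient of [t^k]
   for [M = X A] is 1/k times the weight sum of all closed walks of length [k],
   each multiplied by the variables of the vertices it visits.  Keeping the
   squarefree monomials keeps the walks without repeated vertices.  Such walks
   are cycles with a base point: every directed cycle of length [k] arises from
   exactly [k] of them, every undirected one of length [k > 2] from [2k], and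
   every edge from two walks of length 2.  As the diagram is reduced, the Tait
   graphs have no loops. *)
From HB Require Import structures.
Require Import Defs.

Set Implicit Arguments.
Unset Strict Implicit.
Unset Printing Implicit Defensive.

Import GRing.Theory Num.Theory.

Local Open Scope ring_scope.

(** * Jacobi's formula and the logarithmic derivative of a determinant *)

Lemma deriv_prod (R : comNzRingType) (I : finType) (F : I -> {poly R}) :
  (\prod_i F i)^`() = \sum_i (F i)^`() * \prod_(j | j != i) F j.
Proof.
elim: (index_enum I) (index_enum_uniq I) => [|x s IHs] /=.
  by move=> _; rewrite !big_nil derivC.
case/andP=> xs /IHs{}IHs; rewrite !big_cons derivM IHs eqxx /= big_distrr /=.
congr (_ * _ + _).
  rewrite big_seq_cond [RHS]big_seq_cond; apply: eq_bigl => j.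
  by case: (boolP (j \in s)) => //= js; case: eqP xs => // <-; rewrite js.
rewrite big_seq [RHS]big_seq; apply: eq_bigr => i i_s.
rewrite big_cons ifT 1?mulrCA //.
by apply: contraNneq xs => ->.
Qed.

(** Jacobi's formula: the determinant is linear in each row, so its derivative is the sum of the
    determinants with one row differentiated, each of which is expanded along that row. *)
Lemma deriv_det (R : comNzRingType) n (A : 'M[{poly R}]_n) :
  (\det A)^`() = \tr (\adj A *m map_mx (@deriv R) A).
Proof.
rewrite mxtrace_mulC /determinant /mxtrace raddf_sum /=.
pose B i := \matrix_(k, j) if k == i then (A k j)^`() else A k j.
transitivity (\sum_i \det (B i)).
  rewrite exchange_big; apply: eq_bigr => s _ /=.
  have -> (b : bool) (p : {poly R}) : ((-1) ^+ b * p)^`() = (-1) ^+ b * p^`().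
    by rewrite !mulr_sign; case: b; rewrite ?derivN.
  rewrite deriv_prod big_distrr; apply: eq_bigr => i _ /=; congr (_ * _).
  rewrite [RHS](bigD1 i) //= mxE eqxx; congr (_ * _).
  by apply: eq_bigr => j /negPf ji; rewrite mxE ji.
apply: eq_bigr => i _; rewrite (expand_det_row _ i) mxE.
apply: eq_bigr => j _; rewrite !mxE eqxx; congr (_ * (_ * \det _)).
apply/matrixP=> k l; rewrite !mxE ifN // eq_sym.
exact: neq_lift.
Qed.

(* Newton's identities in generating function form.  With [N = tM] and
   [f = det (1 - N)], Jacobi's formula gives
   [f' = - f tr(M (1 + N + N^2 + ...))]; both geometric series are truncated. *)
Lemma log_deriv_det_coef (R : comNzRingType) n (M : 'M[R]_n) k :
  let f := \det (1%:M - 'X *: map_mx polyC M) in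
  ((\sum_(j < k.+1) (1 - f) ^+ j) * f^`())`_k = - \tr (M ^+ k.+1).
Proof.
move=> f; set Mp := map_mx polyC M; pose N := 'X *: Mp.
have MpX j : Mp ^+ j = map_mx polyC (M ^+ j) by rewrite rmorphXn.
have NX j : N ^+ j = 'X^j *: Mp ^+ j.
  elim: j => [|j IHj]; first by rewrite !expr0 scale1r.
  rewrite !exprS IHj -!mulmxE -scalemxAl -scalemxAr scalerA.
  by rewrite -exprS.
have geomN : (1%:M - N) *m (\sum_(j < k.+1) N ^+ j) = 1%:M - N ^+ k.+1.
  by have /(congr1 -%R) := subrX1 N k.+1; rewrite opprB -mulNr opprB => ->.
have df : f^`() = - \tr (\adj (1%:M - N) *m Mp).
  rewrite deriv_det -[RHS]raddfN -mulmxN; congr (\tr (_ *m _)).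
  apply/matrixP=> i j; rewrite !mxE derivB derivM derivX !derivC mulr0 addr0 mul1r.
  by case: eqP; rewrite ?derivC sub0r.
(* [T] truncates tr(M (1 + N + N^2 + ...)); writing [f] as [\adj (1%:M - N) *m (1%:M - N)] makes
   [f * T] telescope. *)
pose T := \tr ((\sum_(j < k.+1) N ^+ j) *m Mp).
have fT : f * T = - f^`() - 'X^(k.+1) * \tr (\adj (1%:M - N) *m Mp ^+ k.+1 *m Mp).
  rewrite df opprK -mxtraceZ -mul_scalar_mx mulmxA -mul_adj_mx.
  rewrite -[_ *m _ *m \sum_(_ < _) _]mulmxA geomN mulmxBr mulmx1 mulmxBl raddfB.
  by rewrite NX -scalemxAr -scalemxAl /= mxtraceZ.
(* The constant term of [f] is the determinant of the identity, so ['X] divides [1 - f] and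
   [(1 - f) ^+ k.+1] has no terms below degree [k.+1]. *)
have [h defh] : exists h, 1 - f = 'X * h.
  exists (drop_poly 1 (1 - f)); rewrite -{1}[1 - f](poly_take_drop 1) expr1.
  rewrite [take_poly 1 _](_ : _ = 0) ?add0r ?commr_polyX //.
  apply/polyP=> i; rewrite coef_take_poly coef0; case: i => //=.
  rewrite coefB coef1 -horner_coef0 /f -/(horner_eval 0 _) -det_map_mx.
  suff -> : map_mx (horner_eval 0) (1%:M - N) = 1%:M by rewrite det1 subrr.
  apply/matrixP=> i j; rewrite !mxE /horner_eval !hornerE.
  by rewrite subr0; case: eqP; rewrite hornerE.
have geomf : (\sum_(j < k.+1) (1 - f) ^+ j) * f = 1 - (1 - f) ^+ k.+1.
  have := subrX1 (1 - f) k.+1; rewrite addrAC subrr add0r mulNr => /(congr1 -%R).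
  by rewrite opprK opprB mulrC => ->.
have -> : f^`() = - (f * T + 'X^(k.+1) * \tr (\adj (1%:M - N) *m Mp ^+ k.+1 *m Mp)).
  by rewrite fT subrK opprK.
rewrite mulrN mulrDr mulrA geomf mulrBl mul1r defh exprMn mulrCA -mulrA.
rewrite coefN !coefD coefN !coefXnM ltnSn subr0 addr0; congr (- _).
(* The summand of [T] with index [j] is ['X^j] times the trace of [M ^+ j.+1], so only [j = k]
   counts. *)
rewrite /T mulmx_suml raddf_sum coef_sum /= big_ord_recr /= big1 ?add0r.
  by rewrite NX -scalemxAl mxtraceZ coefXnM ltnn subnn mulmxE -exprSr MpX
    trace_map_mx coefC.
move=> j _; rewrite NX -scalemxAl mxtraceZ mulmxE -exprSr MpX trace_map_mx.
by rewrite coefMC coefXn gtn_eqF ?mul0r.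
Qed.

(** Differentiating the truncated logarithm series term by term cancels the denominators and leaves
    a truncated geometric series for 1/f. *)
Lemma natr_formal_log n (f : {poly {mpoly Qwr[n]}}) k :
  k.+1%:R * formal_log f k.+1 = ((\sum_(j < k.+1) (1 - f) ^+ j) * f^`())`_k.
Proof.
rewrite /formal_log big_add1 /= big_mkord mulr_suml coef_sum big_distrr /=.
apply: eq_bigr => j _; rewrite mulrCA mulr_natl -coef_deriv deriv_exp derivB.
rewrite derivC subr0 coefMn mulrnAr -mulrnAl.
have -> : @rat_const n ((-1) ^+ j.+2 / j.+1%:R) *+ j.+1 = (-1) ^+ j.
  rewrite /rat_const -!raddfMn -[_ / _ *+ _]mulr_natr divfK ?pnatr_eq0 //=.
  by rewrite -signr_odd /= negbK signr_odd !(rmorphXn, rmorphN, rmorph1).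
rewrite -(opprB f 1) [(- (f - 1)) ^+ j]exprNn -!(signr_odd _ j) -mulrA.
rewrite !mulr_sign [in RHS]mulrC.
by case: (odd j); rewrite ?coefN.
Qed.

(** * Sums of squarefree coefficients *)

Fact sq_is_zmod_morphism n : zmod_morphism (@sq n).
Proof.
move=> p q; rewrite /sq -sumrB; apply: eq_bigr => S _.
by rewrite mcoeffB.
Qed.

HB.instance Definition _ n :=
  GRing.isZmodMorphism.Build {mpoly Qwr[n]} Qwr (@sq n) (@sq_is_zmod_morphism n).

(** The exponent of ['X_i] is the number of occurrences of [i] in [s]. All exponents are at most 1
    exactly when [s] has no repetition, and then the support of [s] is the only subset that
    contributes. *)
Lemma sq_monomial n (c : Qwr) (s : seq 'I_n) :
  sq (c%:MP_[n] * \prod_(i <- s) 'X_i) = c *+ uniq s.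
Proof.
pose m := (\sum_(i <- s) U_(i))%MM.
have -> : \prod_(i <- s) 'X_i = 'X_[m] :> {mpoly Qwr[n]}.
  by rewrite -(big_map mnm1 xpredT (fun m => 'X_[Qwr, m])) mpolyX_prod big_map.
have mE i : m i = count_mem i s.
  rewrite mnm_sumE -sum1_count [RHS]big_mkcond; apply: eq_bigr => j _ /=.
  by rewrite mnm1E; case: eqP.
rewrite /sq; under eq_bigr do rewrite mcoeffCM mcoeffX.
case: (boolP (uniq s)) => [Us | /negP nUs]; last first.
  rewrite big1 // => S _; case: eqP => [mS|]; rewrite ?mulr0 //; case: nUs.
  apply/count_mem_uniq => i; have := congr1 (fun m : 'X_{1..n} => m i) mS.
  rewrite mE mnmE => si; rewrite si -has_pred1 has_count si.
  by case: (i \in S).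
rewrite (bigD1 [set i in s]) //= big1 ?addr0.
  case: eqP; rewrite ?mulr1 // => [[]]; apply/mnmP=> i.
  by rewrite mE mnmE inE count_uniq_mem.
move=> S /eqP nS; case: eqP => [mS|]; rewrite ?mulr0 //; case: nS.
apply/setP=> i; have := congr1 (fun m : 'X_{1..n} => m i) mS.
rewrite mE mnmE inE count_uniq_mem //.
by case: (i \in s); case: (i \in S).
Qed.

(** * Traces of matrix powers as sums over closed walks *)

Lemma big_tuple_cons (R : Type) (idx : R) (op : Monoid.com_law idx)
    (T : finType) k (F : seq T -> R) :
  \big[op/idx]_(s : k.+1.-tuple T) F s =
  \big[op/idx]_x \big[op/idx]_(s : k.-tuple T) F (x :: s).
Proof.
rewrite pair_big /= (reindex (fun p : T * k.-tuple T => [tuple of p.1 :: p.2])) //=.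
exists (fun t : k.+1.-tuple T => (thead t, [tuple of behead t])) => [[x s]|t] _.
  by rewrite theadE; congr (_, _); apply: val_inj.
by apply: val_inj; rewrite /= {3}(tuple_eta t).
Qed.

(** [s] lists the interior vertices of a walk from [i] to [j], and the [zip] lists its steps. *)
Lemma expr_mx_walks (R : comNzRingType) n (M : 'M[R]_n) k i j :
  (M ^+ k.+1) i j =
  \sum_(s : k.-tuple 'I_n) \prod_(a <- zip (i :: s) (rcons s j)) M a.1 a.2.
Proof.
elim: k i => [|k IHk] i.
  rewrite expr1 (big_pred1 [tuple]) /= => [|s]; first by rewrite big_seq1.
  by rewrite [s]tuple0; apply/esym/eqP.
rewrite exprS -mulmxE mxE.
rewrite (big_tuple_cons _ _
  (fun s => \prod_(a <- zip (i :: s) (rcons s j)) M a.1 a.2)).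
apply: eq_bigr => l _; rewrite IHk big_distrr; apply: eq_bigr => s _ /=.
by rewrite big_cons.
Qed.

Lemma mxtrace_expr_cycles (R : comNzRingType) n (M : 'M[R]_n) k :
  \tr (M ^+ k.+1) =
  \sum_(s : k.+1.-tuple 'I_n) \prod_(a <- zip s (seq.rot 1 s)) M a.1 a.2.
Proof.
rewrite (big_tuple_cons _ _ (fun s => \prod_(a <- zip s (seq.rot 1 s)) M a.1 a.2)).
apply: eq_bigr => i _; rewrite expr_mx_walks; apply: eq_bigr => s _.
by rewrite /= /seq.rot /= drop0 take0 cats1.
Qed.

(** Relates closed walks, whose steps are taken by position, to cycles described by [next], which
    looks its argument up by value. *)
Lemma map_next (T : eqType) (s : seq T) : uniq s -> map (next s) s = seq.rot 1 s.
Proof.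
case: s => [//|x s] Us; have := cycle_next Us; set f := next _.
rewrite /= /seq.rot /= drop0 take0 cats1.
have fpath_map y p : fpath f y p -> map f (belast y p) = p.
  by elim: p y => //= z p IHp y /andP[/eqP -> /IHp->].
by move/fpath_map; rewrite belast_rcons.
Qed.

Lemma natr_sq_neg_log_det n (A : 'M[Qwr]_n) k : (0 < k)%N ->
  sq_neg_log_det A k *+ k =
  \sum_(s : k.-tuple 'I_n | uniq s) \prod_(i <- s) A i (next s i).
Proof.
case: k => // k _.
rewrite /sq_neg_log_det -raddfMn mulNrn -mulr_natl natr_formal_log.
rewrite /char_det log_deriv_det_coef opprK.
set M := diag_mx _ *m _.
rewrite mxtrace_expr_cycles raddf_sum /= [RHS]big_mkcond.
apply: eq_bigr => s _.
(* Each step contributes the variable of its starting vertex, so a closed walk carries the monomial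
   of all its vertices. *)
have -> : \prod_(a <- zip s (seq.rot 1 s)) M a.1 a.2 =
    (\prod_(a <- zip s (seq.rot 1 s)) A a.1 a.2)%:MP_[n] * \prod_(i <- s) 'X_i.
  rewrite -[X in _ * \prod_(_ <- X) _](@unzip1_zip _ _ s (seq.rot 1 s)) ?size_rot //.
  rewrite big_map rmorph_prod -big_split; apply: eq_bigr => a _ /=.
  by rewrite /M mul_diag_mx !mxE mulrC.
rewrite sq_monomial; case: ifP => // Us; rewrite mulr1n -map_next //.
by rewrite -{1}[tval s]map_id zip_map big_map.
Qed.

(** * Counting the tuples that represent a given cycle *)

Lemma sum_const_fibres (V : nmodType) (I J : finType) (A : {pred I})
    (h : I -> J) (F : J -> V) m :
    (forall i, i \in A -> #|[set j in A | h j == h i]| = m) ->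
  \sum_(i in A) F (h i) = (\sum_(j in [set h i | i in A]) F j) *+ m.
Proof.
move=> fibre; rewrite -sumrMnl (partition_big h (mem (h @: A))) /=; last first.
  by move=> i; apply: imset_f.
apply: eq_bigr => _ /imsetP[i /fibre <- ->].
rewrite -sumr_const; apply: eq_big => [j|j /andP[_ /eqP->] //].
by rewrite inE.
Qed.

(** Once [s] is rotated to start at the head of [t], both lists are trajectories of the same map,
    from the same point and of the same length. *)
Lemma rot_of_eq_next (T : eqType) (s t : seq T) :
    uniq s -> uniq t -> (0 < size s)%N -> size s = size t -> s =i t ->
    {in s, next s =1 next t} ->
  exists2 i, (i < size s)%N & t = seq.rot i s.
Proof.
move=> Us Ut s_gt0 sz_st eq_st eq_next.
case: t Ut sz_st eq_st eq_next => [|y t] Ut sz_st eq_st eq_next.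
  by rewrite sz_st in s_gt0.
have /rot_to[i s' def_s]: y \in s by rewrite eq_st mem_head.
have cyc_s' : fcycle (next (y :: t)) (y :: s').
  have : fcycle (next s) (y :: s') by rewrite -def_s rot_cycle cycle_next.
  apply: (@sub_in_cycle _ (mem s)) => [x z xs _ /=|]; first by rewrite eq_next.
  by apply/allP=> x; rewrite -def_s mem_rot.
have sz_s' : size s' = size t.
  by apply: succn_inj; rewrite -[RHS]sz_st -(size_rot i s) def_s.
have eq_s' : s' = t.
  have /fpathP[m] := cyc_s'; have /fpathP[m'] := cycle_next Ut.
  move=> dt ds; have : rcons s' y = rcons t y; last by case/rcons_inj.
  have := congr1 size dt; have := congr1 size ds.
  by rewrite !size_rcons !size_traject ds dt sz_s' => <- <-.
(* An index past the end rotates trivially and is replaced by [0]. *)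
case: (ltnP i (size s)) => [|le_s_i].
  by exists i; rewrite // def_s eq_s'.
by exists 0%N; rewrite // rot0 -eq_s' -def_s rot_oversize.
Qed.

(** The head of [rot i s] is the entry of [s] at position [i], and distinct positions hold distinct
    entries. *)
Lemma rot_uniq_inj (T : eqType) (s : seq T) i j : uniq s ->
  (i < size s)%N -> (j < size s)%N -> seq.rot i s = seq.rot j s -> i = j.
Proof.
case: s => // x s Us i_s j_s eq_rot; apply/eqP.
rewrite -(nth_uniq x i_s j_s Us); apply/eqP.
have nth_rot0 m : (m < size (x :: s))%N ->
    nth x (seq.rot m (x :: s)) 0 = nth x (x :: s) m.
  by move=> m_s; rewrite nth_cat size_drop subn_gt0 m_s nth_drop addn0.
by rewrite -!nth_rot0 ?eq_rot.
Qed.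

(** This keeps apart the edges of a cycle, and also its two orientations, which coincide at length
    2. *)
Lemma next_next_neq (T : eqType) (s : seq T) x :
  uniq s -> (2 < size s)%N -> x \in s -> next s (next s x) != x.
Proof.
move=> Us s_gt2 /rot_to[i p def_s].
rewrite -!(next_rot i Us) def_s.
have: uniq (x :: p) by rewrite -def_s rot_uniq.
have: (2 < size (x :: p))%N by rewrite -def_s size_rot.
case: p {def_s} => [|y [|z p]] //= _.
rewrite !inE !negb_or -!andbA => /and5P[xy xz _ yz _].
by rewrite eqxx [y == x]eq_sym (negPf xy) eqxx eq_sym.
Qed.

Lemma next_neq (T : eqType) (s : seq T) x :
  uniq s -> (2 < size s)%N -> x \in s -> next s x != x.
Proof.
move=> Us s_gt2 xs; apply: contra_neq (next_next_neq Us s_gt2 xs) => eq_x.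
by rewrite !eq_x.
Qed.

(** * Directed cycles as sets of arcs *)

Section Arcs.

Variables (R : comNzRingType) (G : wdigraph R).
Implicit Types s t : seq (dg_point G).

(** The arc set is the graph of [next s] on the entries of [s]. *)
Lemma cycle_arcs_eqP s t :
  cycle_arcs s = cycle_arcs t <-> s =i t /\ {in s, next s =1 next t}.
Proof.
have sub s' t' : cycle_arcs s' \subset cycle_arcs t' ->
    forall x, x \in s' -> x \in t' /\ next s' x = next t' x.
  move=> /subsetP sub x xs.
  have /sub/imsetP[y yt [-> ->]] // : (x, next s' x) \in cycle_arcs s'.
  by apply: imset_f.
split=> [eq_st | [eq_st eq_next]].
  have [sub_st sub_ts] := (sub s t, sub t s).
  rewrite eq_st in sub_st; rewrite eq_st in sub_ts.
  split=> [x|x /sub_st[] //].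
  by apply/idP/idP => [/sub_st[]|/sub_ts[]].
apply/setP=> a; apply/imsetP/imsetP => -[x xs ->]; exists x => //.
- by rewrite -eq_st.
- by rewrite eq_next.
- by rewrite eq_st.
- by rewrite eq_next ?eq_st.
Qed.

(** The fibre consists of the rotations of [s], of which [k] are distinct. *)
Lemma card_cycle_arcs_fibre k (s : k.-tuple (dg_point G)) : (0 < k)%N -> uniq s ->
  #|[set t : k.-tuple (dg_point G) | uniq t && (cycle_arcs t == cycle_arcs s)]| = k.
Proof.
move=> k_gt0 Us.
transitivity #|[set [tuple of seq.rot i s] | i : 'I_k]|; last first.
  rewrite card_imset ?card_ord // => i j /(congr1 val) /= /(rot_uniq_inj Us).
  by rewrite size_tuple => /(_ (ltn_ord i) (ltn_ord j)) /ord_inj.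
apply: eq_card => t; rewrite inE; apply/andP/imsetP.
  case=> Ut /eqP/esym/cycle_arcs_eqP[eq_st eq_next].
  have [||i] := rot_of_eq_next Us Ut _ _ eq_st eq_next; rewrite ?size_tuple //.
  by move=> i_k def_t; exists (Ordinal i_k) => //; apply: val_inj.
case=> i _ ->; rewrite /= rot_uniq; split=> //.
apply/eqP/cycle_arcs_eqP; split=> x; first by rewrite mem_rot.
by move=> _; rewrite next_rot.
Qed.

Lemma prod_cycle_arcs s (w : dg_point G * dg_point G -> R) : uniq s ->
  \prod_(a in cycle_arcs s) w a = \prod_(x <- s) w (x, next s x).
Proof.
by move=> Us; rewrite [RHS]big_uniq // big_imset //= => x y _ _ [].
Qed.

End Arcs.

(** * Undirected cycles as sets of edges *)

Section Edges.

Variables (R : comNzRingType) (G : wgraph R).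
Implicit Types s t : seq (g_point G).

(** A tuple of points of [G] is also read as a directed cycle of [bidirect G], which remembers the
    orientation. *)
Let arcs s : {set g_point G * g_point G} := @cycle_arcs R (bidirect G) s.

Lemma cycle_edges_arcs s : cycle_edges s = [set [set a.1; a.2] | a in arcs s].
Proof. by rewrite -imset_comp. Qed.

Lemma mem_cycle_edges s x : uniq s ->
  x \in s <-> exists2 e, e \in cycle_edges s & x \in e.
Proof.
move=> Us; split=> [xs | [_ /imsetP[y ys ->]]].
  by exists [set x; next s x]; rewrite ?set21 //; apply: imset_f.
by case/set2P=> ->; rewrite ?mem_next.
Qed.

Lemma cycle_edges_rev s : uniq s -> cycle_edges (rev s) = cycle_edges s.
Proof.
move=> Us; apply/setP=> e; apply/imsetP/imsetP => -[x].
  rewrite mem_rev => xs ->; exists (prev s x); first by rewrite mem_prev.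
  by rewrite next_prev // next_rev // setUC.
move=> xs ->; exists (next s x); first by rewrite mem_rev mem_next.
by rewrite next_rev // prev_next // setUC.
Qed.

(** The edge set leaves only the orientation open. One common step fixes it, and the agreement then
    spreads along the cycle. *)
Lemma eq_next_of_cycle_edges s t x : uniq s -> uniq t -> (2 < size s)%N ->
    cycle_edges s = cycle_edges t -> x \in s -> next s x = next t x ->
  {in s, next s =1 next t}.
Proof.
move=> Us Ut s_gt2 eq_st xs eq_x y ys.
(* The edge by which [s] leaves [z'] is an edge of [t] at [z'] and, as [s] has
   more than two vertices, differs from the edge [{z, z'}]. *)
have step z (z' := next s z) : z \in s -> next s z = next t z ->
    next s z' = next t z'.
  move=> zs eq_z; have z's : z' \in s by rewrite mem_next.
  have next_neq := next_neq Us s_gt2 z's.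
  have: [set z'; next s z'] \in cycle_edges t.
    by rewrite -eq_st; apply: imset_f; rewrite mem_next.
  case/imsetP=> u _ eq_u.
  have /set2P[zu | zu] : z' \in [set u; next t u] by rewrite -eq_u set21.
    have /set2P[eq_nt|->] : next s z' \in [set u; next t u];
      [by rewrite -eq_u set22 | | by rewrite -zu].
    by rewrite -zu in eq_nt; case/eqP: next_neq.
  (* Otherwise [t] enters [z'] by this edge, so [u] is [z] and [s] would turn back to [z] or stay at
     [z']. *)
  have def_u : u = z by apply: (can_inj (prev_next Ut)); rewrite -zu -eq_z.
  have /set2P[eq_nz|eq_nz] : next s z' \in [set z; z'].
    by rewrite {2}zu -def_u -eq_u set22.
    by case/eqP: (next_next_neq Us s_gt2 zs).
  by case/eqP: next_neq.
have /iter_findex <- : fconnect (next s) x y.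
  by rewrite (fconnect_cycle (cycle_next Us) xs).
elim: (findex _ _ _) => [//|m IHm] /=; apply: step => //.
by elim: m {IHm} => [//|m IHm] /=; rewrite mem_next.
Qed.

(** An edge of [t] is traversed by [s] in the same or in the opposite direction; this single edge
    decides between [s] and [rev s]. *)
Lemma cycle_edges_eqP s t : uniq s -> uniq t -> (2 < size s)%N ->
    size t = size s ->
  (cycle_edges t == cycle_edges s)
    = (arcs t == arcs s) || (arcs t == arcs (rev s)).
Proof.
move=> Us Ut s_gt2 sz_st; apply/eqP/orP; last first.
  case=> /eqP; first by rewrite !cycle_edges_arcs => ->.
  by rewrite -(cycle_edges_rev Us) !cycle_edges_arcs => ->.
move=> eq_st; have t_gt2 : (2 < size t)%N by rewrite sz_st.
have mem_ts : t =i s.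
  move=> x; apply/idP/idP.
    by move=> /(mem_cycle_edges x Ut); rewrite eq_st => /(mem_cycle_edges x Us).
  by move=> /(mem_cycle_edges x Us); rewrite -eq_st => /(mem_cycle_edges x Ut).
have [x xt] : exists x, x \in t.
  by case: (t) t_gt2 => // x p; exists x; apply: mem_head.
have : [set x; next t x] \in cycle_edges s by rewrite -eq_st; apply: imset_f.
case/imsetP=> y _ eq_y.
have /set2P[xy|xy] : x \in [set y; next s y] by rewrite -eq_y set21.
  left; apply/eqP/(@cycle_arcs_eqP R (bidirect G)); split=> //.
  apply: (eq_next_of_cycle_edges Ut Us t_gt2 eq_st xt).
  have /set2P[eq_x|] : next t x \in [set y; next s y] by rewrite -eq_y set22.
    by case/eqP: (next_neq Ut t_gt2 xt); rewrite eq_x.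
  by rewrite -xy.
right; apply/eqP/(@cycle_arcs_eqP R (bidirect G)); split=> [z|].
  by rewrite mem_rev mem_ts.
apply: (@eq_next_of_cycle_edges t (rev s) x); rewrite ?rev_uniq ?cycle_edges_rev //.
rewrite next_rev // xy prev_next // -xy.
have /set2P[//|eq_x] : next t x \in [set y; next s y] by rewrite -eq_y set22.
by case/eqP: (next_neq Ut t_gt2 xt); rewrite eq_x.
Qed.

Lemma card_cycle_edges_fibre k (s : k.-tuple (g_point G)) : (2 < k)%N -> uniq s ->
  #|[set t : k.-tuple (g_point G) | uniq t && (cycle_edges t == cycle_edges s)]|
    = (k * 2)%N.
Proof.
move=> k_gt2 Us; have k_gt0 := ltn_trans (ltn0Sn 1) k_gt2.
pose fibre (r : k.-tuple (g_point G)) :=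
  [set t : k.-tuple (g_point G) | uniq t && (arcs t == arcs r)].
transitivity #|fibre s :|: fibre [tuple of rev s]|.
  apply: eq_card => t; rewrite !inE -andb_orr; case: (boolP (uniq t)) => //= Ut.
  by rewrite cycle_edges_eqP ?size_tuple.
rewrite cardsU disjoint_setI0 ?cards0.
  rewrite subn0 !(@card_cycle_arcs_fibre R (bidirect G)) ?rev_uniq //.
  by rewrite muln2 addnn.
(* A tuple in both fibres would make [next s] agree with [prev s], so that two steps lead back to
   the start. *)
rewrite -setI_eq0; apply/eqP/setP=> t; rewrite !inE; apply/negP.
case/andP=> /andP[_ /eqP->] /andP[_ /eqP].
case/(@cycle_arcs_eqP R (bidirect G))=> _ eq_rev.
have s_gt2 : (2 < size s)%N by rewrite size_tuple.
have [x xs] : exists x, x \in tval s.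
  by case: (tval s) s_gt2 => // x p; exists x; apply: mem_head.
case/eqP: (next_next_neq Us s_gt2 xs).
by rewrite (eq_rev x xs) next_rev // next_prev.
Qed.

(** If two distinct vertices gave the same edge, each would be the successor of the other. *)
Lemma prod_cycle_edges s (w : {set g_point G} -> R) : uniq s -> (2 < size s)%N ->
  \prod_(e in cycle_edges s) w e = \prod_(x <- s) w [set x; next s x].
Proof.
move=> Us s_gt2; rewrite [RHS]big_uniq // big_imset //= => x y xs ys eq_xy.
have /set2P[//|x_ny] : x \in [set y; next s y] by rewrite -eq_xy set21.
have /set2P[//|y_nx] : y \in [set x; next s x] by rewrite eq_xy set21.
by case/eqP: (next_next_neq Us s_gt2 xs); rewrite -y_nx.
Qed.

End Edges.

(** * Weighted sums over cycles with a base point *)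

Section CycleSums.

Variables (R : comNzRingType) (G : wgraph R).
Implicit Types (k : nat) (e : {set g_point G}).

(** Cycles with a base point and a direction: the common form in which the coefficients of the
    logarithm meet the cycle sums. *)
Definition tuple_cycles k : {set k.-tuple (g_point G)} :=
  [set s : k.-tuple (g_point G) | uniq s && (cycle_edges s \subset g_edges G)].

Definition tuple_cycle_sum k : R :=
  \sum_(s in tuple_cycles k) \prod_(x <- s) g_weight [set x; next s x].

Lemma cycle_arcs_sub (s : seq (g_point G)) :
  (@cycle_arcs R (bidirect G) s \subset dg_arcs (bidirect G))
    = (cycle_edges s \subset g_edges G).
Proof.
apply/subsetP/subsetP => sub _ /imsetP[x xs ->].
  have := sub (x, next s x); rewrite inE /=; apply.
  exact: imset_f.
by rewrite inE /=; apply/sub/imset_f.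
Qed.

Lemma tuple_cycle_sum_directed k : (0 < k)%N ->
  tuple_cycle_sum k =
  (\sum_(C in directed_cycles (bidirect G) k) \prod_(a in C) dg_weight a) *+ k.
Proof.
move=> k_gt0; pose A := [set s : k.-tuple (dg_point (bidirect G)) |
  uniq s && (cycle_arcs s \subset dg_arcs (bidirect G))].
rewrite -[directed_cycles _ _]/[set @cycle_arcs R (bidirect G) s
  | s : k.-tuple (dg_point (bidirect G)) in A].
rewrite -(@sum_const_fibres R _ _ (mem A) (@cycle_arcs R (bidirect G)))
  => [|s]; last first.
  rewrite inE => /andP[Us sub_s].
  rewrite -[RHS](card_cycle_arcs_fibre k_gt0 Us); apply: eq_card => t.
  rewrite !inE /= -andbA; case: eqP => [eq_ts|]; rewrite ?andbF //.
  by rewrite eq_ts sub_s andbT.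
apply: eq_big => [s|s]; rewrite !inE ?cycle_arcs_sub // => /andP[Us _].
by rewrite prod_cycle_arcs.
Qed.

Lemma tuple_cycle_sum_simple k : (2 < k)%N ->
  tuple_cycle_sum k =
  (\sum_(C in simple_cycles G k) \prod_(e in C) g_weight e) *+ (k * 2).
Proof.
move=> k_gt2; rewrite -[simple_cycles _ _]/[set cycle_edges s
  | s : k.-tuple (g_point G) in tuple_cycles k].
rewrite -(@sum_const_fibres R _ _ (mem (tuple_cycles k))) => [|s]; last first.
  rewrite inE => /andP[Us sub_s].
  rewrite -[RHS](card_cycle_edges_fibre k_gt2 Us); apply: eq_card => t.
  rewrite !inE /= -andbA; case: eqP => [eq_ts|]; rewrite ?andbF //.
  by rewrite eq_ts sub_s andbT.
apply: eq_bigr => s; rewrite inE => /andP[Us _].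
by rewrite prod_cycle_edges ?size_tuple.
Qed.

Hypothesis edge_card2 : forall e, e \in g_edges G -> #|e| = 2.
Hypothesis edge_sub_verts : forall e, e \in g_edges G -> e \subset g_verts G.

(** A cycle of length 1 would need a loop [[set x]]. *)
Lemma tuple_cycle_sum1 : tuple_cycle_sum 1 = 0.
Proof.
apply: big_pred0 => s; apply/negP; rewrite inE => /andP[_ /subsetP sub_s].
case/tupleP: s sub_s => x s; rewrite [s]tuple0 => /(_ [set x]) sub_s.
have /sub_s/edge_card2 : [set x] \in cycle_edges [:: x].
  by apply/imsetP; exists x; rewrite ?mem_head //= eqxx setUid.
by rewrite cards1.
Qed.

(** A tuple of length 2 runs along its edge forth and back, whence the square; the factor 2 counts
    the starting points. *)
Lemma tuple_cycle_sum2 :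
  tuple_cycle_sum 2 = (\sum_(e in g_edges G) g_weight e ^+ 2) *+ 2.
Proof.
pose h (s : 2.-tuple (g_point G)) := [set x in tval s].
have h2 x y : h [tuple x; y] = [set x; y].
  by apply/setP=> z; rewrite !inE.
have cyc2 x y : x != y -> cycle_edges [:: x; y] = [set [set x; y]].
  move=> xy; apply/setP=> e; rewrite inE; apply/imsetP/eqP => [[z]|->].
    rewrite !inE => /orP[] /eqP-> -> /=; first by rewrite eqxx.
    by rewrite eq_sym (negPf xy) eqxx setUC.
  by exists x; rewrite ?mem_head //= eqxx.
have tuple2 (s : 2.-tuple (g_point G)) : exists x y, s = [tuple x; y].
  case/tupleP: s => x s; case/tupleP: s => y s; exists x, y.
  by rewrite [s]tuple0; apply: val_inj.
have eq2 (x y u v : g_point G) :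
    ([tuple x; y] == [tuple u; v]) = (x == u) && (y == v).
  by rewrite -val_eqE /= !eqseq_cons andbT.
have A2 x y : ([tuple x; y] \in tuple_cycles 2)
    = (x != y) && ([set x; y] \in g_edges G).
  rewrite inE /= inE andbT; case: (boolP (x == y)) => //= xy.
  by rewrite cyc2 // sub1set.
have -> : g_edges G = [set h s | s in tuple_cycles 2].
  apply/setP=> e; apply/idP/imsetP => [eE|[s As ->]].
    have /eqP/cards2P[x [y [xy def_e]]] := edge_card2 eE.
    by exists [tuple x; y]; rewrite ?h2 // A2 xy -def_e.
  have [x [y def_s]] := tuple2 s; move: As; rewrite def_s A2 h2.
  by case/andP.
rewrite -(@sum_const_fibres R _ _ (mem (tuple_cycles 2)) h
  (fun e => g_weight e ^+ 2)).
  apply: eq_bigr => s; have [x [y ->]] := tuple2 s; rewrite A2 h2 => /andP[xy _].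
  rewrite /= !big_cons big_nil /= eqxx [y == x]eq_sym (negPf xy) eqxx mulr1.
  by rewrite [[set y; x]]setUC.
move=> s; have [x [y ->]] := tuple2 s; rewrite A2 => /andP[xy xyE].
transitivity #|[set [tuple x; y]; [tuple y; x]]|.
  apply: eq_card => t; have [u [v ->]] := tuple2 t.
  rewrite in_set2 in_set /= A2 !h2 !eq2.
  apply/andP/orP => [[/andP[uv _] /eqP eq_uv]|].
    have := set21 u v; have := set22 u v; rewrite eq_uv !inE.
    case/orP=> /eqP vE /orP[] /eqP uE; move: uv; rewrite uE vE ?eqxx //.
      by right.
    by left.
  case=> /andP[/eqP-> /eqP->]; first by rewrite xy xyE.
  by rewrite [[set y; x]]setUC eq_sym xy xyE.
by rewrite cards2 eq2 (negPf xy).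
Qed.

Lemma tuple_cycle_verts k (s : k.-tuple (g_point G)) :
  s \in tuple_cycles k -> {subset s <= g_verts G}.
Proof.
rewrite inE => /andP[_ /subsetP sub_s] x xs.
have /sub_s/edge_sub_verts/subsetP : [set x; next s x] \in cycle_edges s.
  exact: imset_f.
by apply; rewrite set21.
Qed.

Lemma tuple_cycle_sum_gt_verts k : (#|g_verts G| < k)%N -> tuple_cycle_sum k = 0.
Proof.
move=> lt_V_k; apply: big_pred0 => s; apply: contraTF lt_V_k => As.
rewrite -leqNgt -{1}(size_tuple s).
have Us : uniq s by move: As; rewrite inE => /andP[].
rewrite -(card_uniqP Us).
exact/subset_leq_card/subsetP/tuple_cycle_verts.
Qed.

(** Enumerating the vertices embeds index tuples into tuples of points. A step that is not an edge
    puts a zero into the product, so only cycles contribute. *)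
Lemma sum_adjacency_cycles k : (0 < k)%N ->
  \sum_(s : k.-tuple 'I_#|g_verts G| | uniq s)
     \prod_(i <- s) adjacency G i (next s i) = tuple_cycle_sum k.
Proof.
move=> k_gt0.
pose F (t : k.-tuple (g_point G)) : R :=
  if t \in tuple_cycles k then \prod_(x <- t) g_weight [set x; next t x] else 0.
pose m (s : k.-tuple 'I_#|g_verts G|) :=
  [tuple of map (@enum_val _ (mem (g_verts G))) s].
have m_inj : injective m.
  by move=> s t /(congr1 val) /(inj_map enum_val_inj) /val_inj.
transitivity (\sum_(s : k.-tuple 'I_#|g_verts G|) F (m s)).
  rewrite big_mkcond; apply: eq_bigr => s _; rewrite /F inE /=.
  rewrite (map_inj_uniq enum_val_inj); case: (boolP (uniq s)) => //= Us.
  have next_m i := next_map (@enum_val_inj _ (mem (g_verts G))) Us i.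
  rewrite big_map; case: ifPn => [/subsetP sub_s | ].
    rewrite !big_seq; apply: eq_bigr => i i_s; rewrite mxE /= next_m ifT //.
    by rewrite -next_m; apply/sub_s/imset_f/map_f.
  case/subsetPn=> _ /imsetP[_ /mapP[i i_s ->] ->]; rewrite next_m => /negPf notE.
  by rewrite (big_rem i) //= mxE /= notE mul0r.
rewrite /tuple_cycle_sum [RHS]big_mkcond /=.
rewrite -(big_imset F (in2W m_inj)) /= [RHS](bigID (mem (m @: predT))) /=.
(* Tuples outside the image of [m] leave the vertex set and hence are not cycles. *)
rewrite [X in _ + X]big1 ?addr0 //= => t not_m; apply/eqP; apply: contraNT not_m.
case: ifP => [/tuple_cycle_verts sub_t _|]; last by rewrite eqxx.
(* [enum_rank_in] takes a vertex as default; [0 < k] supplies the first entry of [t]. *)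
have t0V : tnth t (Ordinal k_gt0) \in g_verts G by apply/sub_t/mem_tnth.
apply/imsetP; exists [tuple of map (enum_rank_in t0V) t] => //.
apply: val_inj; rewrite /= -map_comp -[LHS]map_id; apply/eq_in_map=> x xt /=.
by rewrite enum_rankK_in ?sub_t.
Qed.

End CycleSums.

(** Allows the factor [k], the number of base points, to be cancelled. *)
Lemma mpoly_rat_natmulI n k : (0 < k)%N ->
  injective (fun p : {mpoly rat[n]} => p *+ k).
Proof.
move=> k_gt0 p q eq_pq; apply/mpolyP=> m; apply: (pmulrnI k_gt0).
by rewrite /= -!mcoeffMn eq_pq.
Qed.

(** * Coefficients of the logarithm for a weighted graph *)

Section NegLogDet.

Variable G : wgraph Qwr.
Hypothesis edge_card2 : forall e, e \in g_edges G -> #|e| = 2.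
Hypothesis edge_sub_verts : forall e, e \in g_edges G -> e \subset g_verts G.

Let c k := sq_neg_log_det (adjacency G) k.

Lemma natr_sq_neg_log_det_adjacency k : (0 < k)%N ->
  c k *+ k = tuple_cycle_sum G k.
Proof.
by move=> k_gt0; rewrite natr_sq_neg_log_det // sum_adjacency_cycles.
Qed.

Lemma sq_neg_log_det0 : c 0 = 0.
Proof. by rewrite /c /sq_neg_log_det /formal_log big_geq // oppr0 raddf0. Qed.

Lemma sq_neg_log_det_directed k : (0 < k)%N ->
  c k = \sum_(C in directed_cycles (bidirect G) k) \prod_(a in C) dg_weight a.
Proof.
move=> k_gt0; apply: (mpoly_rat_natmulI k_gt0).
by rewrite /= natr_sq_neg_log_det_adjacency // tuple_cycle_sum_directed.
Qed.

Lemma sq_neg_log_det1 : c 1 = 0.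
Proof.
by rewrite -[c 1]mulr1n natr_sq_neg_log_det_adjacency // tuple_cycle_sum1.
Qed.

Lemma sq_neg_log_det2 : c 2 = \sum_(e in g_edges G) g_weight e ^+ 2.
Proof.
apply: (@mpoly_rat_natmulI _ 2) => //.
by rewrite /= natr_sq_neg_log_det_adjacency // tuple_cycle_sum2.
Qed.

Lemma sq_neg_log_det_simple k : (2 < k)%N -> c k = 2%:R * cycle_poly G k.
Proof.
move=> k_gt2; have k_gt0 := ltn_trans (ltn0Sn 1) k_gt2.
apply: (mpoly_rat_natmulI k_gt0); rewrite /= natr_sq_neg_log_det_adjacency //.
by rewrite tuple_cycle_sum_simple // /cycle_poly gtn_eqF // mulr_natl -mulrnA mulnC.
Qed.

Lemma sq_neg_log_det_gt_verts k : (#|g_verts G| < k)%N -> c k = 0.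
Proof.
move=> lt_V_k; have k_gt0 := leq_ltn_trans (leq0n _) lt_V_k.
apply: (mpoly_rat_natmulI k_gt0).
by rewrite /= natr_sq_neg_log_det_adjacency // tuple_cycle_sum_gt_verts ?mul0rn.
Qed.

(** A simple cycle has at most as many vertices as the graph, so the series stops there and its
    value at 1 is a finite sum of the [c k]. *)
Lemma sq_neg_log_det_polynomial :
  exists p : {poly Qwr},
    [/\ forall k, p`_k = c k,
        p.[1] = directed_cycle_sum (bidirect G)
      & p.[1] = \sum_(e in g_edges G) g_weight e ^+ 2
                + 2%:R * \sum_(3 <= i < #|g_verts G|.+1) cycle_poly G i].
Proof.
have horner1 : (\poly_(k < #|g_verts G|.+1) c k).[1] =
    \sum_(1 <= k < #|g_verts G|.+1) c k.
  rewrite horner_poly big_ord_recl sq_neg_log_det0 mul0r add0r big_add1 big_mkord.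
  by apply: eq_bigr => k _; rewrite expr1n mulr1.
exists (\poly_(k < #|g_verts G|.+1) c k); split; rewrite ?horner1.
- move=> k; rewrite coef_poly ltnS; case: leqP => // /sq_neg_log_det_gt_verts->.
  by [].
- by apply: eq_big_nat => k /andP[k_gt0 _]; rewrite sq_neg_log_det_directed.
rewrite -sq_neg_log_det2; case: (ltnP 1 #|g_verts G|) => [V_gt1|V_le1].
  rewrite big_ltn 1?ltnW // big_ltn // sq_neg_log_det1 add0r big_distrr /=.
  congr (_ + _); apply: eq_big_nat => k /andP[k_gt2 _].
  exact: sq_neg_log_det_simple.
(* With at most one vertex the term [c 2] does not occur in the sum, and both sides vanish. *)
have -> : c 2 = 0 by apply: sq_neg_log_det_gt_verts.
rewrite [X in 2%:R * X]big_geq ?mulr0 ?addr0; last exact: leq_ltn_trans V_le1 _.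
case: #|g_verts G| V_le1 => [|[|//]] _; first by rewrite big_geq.
by rewrite big_nat1 sq_neg_log_det1.
Qed.

End NegLogDet.

(** * Tait graphs of diagrams *)

Section Tait.

Variables (D : diagram) (b : bool).

Let G := tait_consolidated D b.

(** The corners of colour [b] at a crossing are [i0] and the opposite one, [i0 + 2]. *)
Lemma tait_ends (x : 'I_(d_ncross D)) :
  exists i : 'I_4, mg_ends (w := tait_graph D b) x =
    [set inl (region (@d_edge D) (x, i));
         inl (region (@d_edge D) (opp_dart (x, i)))].
Proof.
pose i0 : 'I_4 := if b then 1 else 0.
exists i0; apply/setP=> F; rewrite !inE; apply/imsetP/orP => [[i] | ].
  rewrite inE => odd_i ->; have : (i == i0) || (i == i0 + 2).
    by rewrite /i0; move: odd_i; case: b; case: i => [[|[|[|[|]]]]].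
  by case/orP=> /eqP->; [left | right].
case=> /eqP->; first by exists i0; rewrite // inE /i0; case: b.
by exists (i0 + 2); rewrite // inE /i0; case: b.
Qed.

(** A loop would be a region meeting a crossing in two opposite corners, which makes the crossing
    nugatory. *)
Lemma tait_edge_card2 : reduced D -> forall e, e \in g_edges G -> #|e| = 2.
Proof.
move=> redD _ /imsetP[x _ ->]; have [i ->] := tait_ends x.
rewrite cards2; case: eqP => // -[eq_regions].
by case: (redD x); exists i.
Qed.

Lemma tait_edge_sub_verts e : e \in g_edges G -> e \subset g_verts G.
Proof.
case/imsetP=> x _ ->; apply/subsetP=> y /imsetP[i]; rewrite inE => odd_i ->.
rewrite in_setU; apply/orP; left; apply/imsetP.
exists (region (@d_edge D) (x, i)) => //; rewrite inE imset_f //=.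
by apply/exists_inP; exists (x, i); rewrite ?inE ?connect0.
Qed.

(** Substitution is a ring morphism, so squaring the variable of each crossing squares the product
    that weights a consolidated edge. *)
Lemma tait_cycle_poly2_squares :
  cycle_poly G 2 \mPo [tuple var_w ^+ 2; var_r ^+ 2]
    = \sum_(e in g_edges G) g_weight e ^+ 2.
Proof.
rewrite /cycle_poly /= raddf_sum; apply: eq_bigr => e _ /=.
rewrite rmorph_prod -prodrXl; apply: eq_bigr => x _ /=.
by case: ifP => _; rewrite comp_mpolyXU.
Qed.

End Tait.

(** The sums over [i > 2] stop at the number of vertices, since longer simple cycles do not
    exist. *)
Theorem corollary4p6 (rule : bool) (L : link) (D : diagram)
    (nonsplitL : non_split L) (alternatingL : alternating_link L)
    (diagramD : diagram_of L D) (alternatingD : alternating D)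
    (reducedD : reduced D) :
  let AB := adjacency (GB rule D) in
  let AW := adjacency (GW rule D) in
  let squares : 2.-tuple Qwr := [tuple var_w ^+ 2; var_r ^+ 2] in
  (* pB and pW are the series sq(-log det(I - t X A)), which are polynomials *)
  exists pB pW : {poly Qwr},
    [/\ forall k, pB`_k = sq_neg_log_det AB k,
        forall k, pW`_k = sq_neg_log_det AW k,
        pB.[1] = (CB rule D 2 \mPo squares)
                 + 2%:R * \sum_(3 <= i < #|g_verts (GB rule D)|.+1) CB rule D i,
        pW.[1] = (CW rule D 2 \mPo squares)
                 + 2%:R * \sum_(3 <= i < #|g_verts (GW rule D)|.+1) CW rule D i
      & [mset pB.[1]; pW.[1]]%mset = WRP rule D].
Proof.
move=> AB AW squares.
(* One statement, for an arbitrary colour [b], serves both Tait graphs. *)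
have tait b := @sq_neg_log_det_polynomial (tait_consolidated D b)
  (tait_edge_card2 reducedD) (@tait_edge_sub_verts D b).
have [pB [coefB dirB simpB]] := tait rule.
have [pW [coefW dirW simpW]] := tait (~~ rule).
exists pB, pW; split; [exact: coefB | exact: coefW | | | ].
- by rewrite simpB -tait_cycle_poly2_squares.
- by rewrite simpW -tait_cycle_poly2_squares.
- by rewrite dirB dirW.
Qed.
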